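(* There is a constant $C>0$, depending on $n$, $m$, $\bar g$ and $w$ but not on $r$, such that $$v_r^+-v_r^-\;\le\; C\,r^{|w|/m}\,\gamma^{-2r}\qquad\text{for all integers } r\ge1,$$ where $\gamma:=\dfrac{\sqrt{\bar g}+1}{\sqrt{\bar g}-1}>1$.
   Context: Setting: $n,m\ge1$ are integers, $w=(w_1,\dots,w_n)$ is a vector of positive integers and $|w|:=\sum_i w_i$. $g:\mathbb{R}^n\to[0,\infty)$ is a polynomial with $g(t^{w_1}x_1,\dots,t^{w_n}x_n)=t^m g(x)$ for all $t>0$, $x\in\mathbb{R}^n$, and $g(x)>0$ for $x\ne0$. Let $B:=[-1,1]^n$ and $K:=\{x\in\mathbb{R}^n: g(x)\le1\}$; it is assumed that $K\subseteq B$. Let $\bar g:=\max_{x\in B}g(x)$; it is assumed that $\bar g>1$. Let $\mu$ be the uniform probability measure on $B$ and $\nu:=g_\#\mu$ its pushforward under $g$, a probability measure on $[0,\bar g]$ with moments $y_k=\int t^k d\nu=2^{-n}\int_B g^k dx$. Let $\nu_w$ be the probability measure on $[0,1]$ with density $\frac{|w|}{m}t^{|w|/m-1}$; its moments are $z_k=\frac{|w|}{|w|+km}$. For a finite signed measure $\sigma$ on $\mathbb{R}$ with compact support, $M_r(\sigma)$ is the $(r+1)\times(r+1)$ matrix with entries $\int t^{i+j}d\sigma(t)$, $0\le i,j\le r$; for a polynomial $h$, $M_{r-1}(h\sigma)$ is the $r\times r$ matrix with entries $\int h(t)t^{i+j}d\sigma(t)$, $0\le i,j\le r-1$. Let $h(t):=(t-1)(\bar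 g-t)$. For symmetric $A$ and symmetric positive definite $C$ of the same size, $\lambda_{\min}(A,C)$ is the smallest real $\lambda$ with $\det(A-\lambda C)=0$. The matrices $M_r(\nu_w)$ and $-M_{r-1}(h\nu_w)$ are positive definite, and $$v_r^+:=2^n\lambda_{\min}\bigl(M_r(\nu),M_r(\nu_w)\bigr),\qquad v_r^-:=-2^n\lambda_{\min}\bigl(M_{r-1}(h\nu),-M_{r-1}(h\nu_w)\bigr).$$ *)

(* Defs.v *)
From HB Require Import structures.
From mathcomp Require Import all_boot all_order all_algebra.
From mathcomp Require Import all_classical all_reals all_analysis.
From mathcomp Require Import measurable_realfun.
(* Not imported: the notations of mpoly clash with those of analysis. *)
From mathcomp Require mpoly.

Set Implicit Arguments.
Unset Strict Implicit.
Unset Printing Implicit Defensive.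

Import Order.TTheory GRing.Theory Num.Theory.
Import numFieldNormedType.Exports.

Local Open Scope classical_set_scope.
Local Open Scope ring_scope.

Notation Rn R n := (n.-tuple (measurableTypeR R)).

Section ImageMeasure.
Context d d' (T : measurableType d) (U : measurableType d') (R : realType).
Variables (m : {measure set T -> \bar R}) (f : T -> U).
Hypothesis mf : measurable_fun setT f.

(* [pushforward m f] is canonically a measure only up to a proof that f is
   measurable, which unification cannot find; here the proof is an argument. *)
Let pf (_ : measurable_fun setT f) := pushforward m f.

Let pf0 : pf mf set0 = 0%E.
Proof. by rewrite /pf /pushforward preimage_set0 measure0. Qed.

Let pf_ge0 A : (0 <= pf mf A)%E.
Proof. exact: measure_ge0. Qed.

Let pf_sigma_additive : semi_sigma_additive (pf mf).
Proof.
exact: (@measure_semi_sigma_additive _ _ _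
  (measure_function_pushforward__canonical__measure_function_Measure m mf)).
Qed.

Definition image_measure_set := pf mf.

HB.instance Definition _ :=
  isMeasure.Build _ _ _ image_measure_set pf0 pf_ge0 pf_sigma_additive.

Definition image_measure : {measure set U -> \bar R} := image_measure_set.

Lemma image_measureE A : image_measure A = m (f @^-1` A).
Proof. by []. Qed.

End ImageMeasure.

Section LebesgueRn.
Context {R : realType}.

Definition tuple_cons n (p : measurableTypeR R * Rn R n) : Rn R n.+1 :=
  [tuple of p.1 :: p.2].

Lemma measurable_tuple_cons n : measurable_fun setT (@tuple_cons n).
Proof. exact: measurable_cons. Qed.

Section Step.
Variables (n : nat) (l : {sigma_finite_measure set (Rn R n) -> \bar R}).

Definition lebesgue_step : set (Rn R n.+1) -> \bar R :=
  image_measure (lebesgue_measure \x l)%E (@measurable_tuple_cons n).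

HB.instance Definition _ := Measure.on lebesgue_step.

Let lebesgue_step_sigma_finite : sigma_finite setT lebesgue_step.
Proof.
have /sigma_finiteP[F [TF ndF Foo]] : sigma_finite setT (@lebesgue_measure R).
  exact: sigma_finiteT.
have /sigma_finiteP[G [TG ndG Goo]] := sigma_finiteT l.
pose u (x : Rn R n.+1) : measurableTypeR R * Rn R n :=
  (tnth x ord0, [tuple of behead x]).
have mu : measurable_fun setT u.
  by apply: measurable_fun_pair; [exact: measurable_tnth|
                                 exact: measurable_behead].
have uK p : u (tuple_cons p) = p.
  by case: p => a b; rewrite /u /tuple_cons /=; congr pair; exact/val_inj.
exists (fun i => u @^-1` (F i `*` G i)).
  apply/esym; rewrite -subTset => x _.
  have : setT (u x).1 by []. rewrite TF => -[i _ Fi].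
  have : setT (u x).2 by []. rewrite TG => -[j _ Gj].
  exists (maxn i j) => //; split.
    by move: Fi; exact/subsetPset/ndF/leq_maxl.
  by move: Gj; exact/subsetPset/ndG/leq_maxr.
move=> i; have [mF Fi] := Foo i; have [mG Gi] := Goo i; split.
  by rewrite -[X in measurable X]setTI; apply: mu => //; exact: measurableX.
rewrite /lebesgue_step image_measureE -comp_preimage.
have -> : u \o @tuple_cons n = id by apply/funext => p /=; rewrite uK.
rewrite preimage_id [X in (X < _)%E]product_measure1E//.
by rewrite lte_mul_pinfty// ge0_fin_numE.
Qed.

HB.instance Definition _ :=
  Measure_isSigmaFinite.Build _ _ _ lebesgue_step lebesgue_step_sigma_finite.

End Step.

(* Lebesgue measure on R^n: the product of n copies of [lebesgue_measure],
   through R^(n+1) = R * R^n, starting from the unit mass on R^0. *)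
Fixpoint lebesgue_Rn n : {sigma_finite_measure set (Rn R n) -> \bar R} :=
  match n with
  | 0 => \d_([tuple] : Rn R 0)
  | n'.+1 => lebesgue_step (lebesgue_Rn n')
  end.

Definition cube n : set (Rn R n) := [set x | forall i, `|tnth x i| <= 1].

Lemma measurable_cube n : measurable (@cube n).
Proof.
have -> : @cube n =
    \bigcap_(i in [set: 'I_n]) ((@tnth n _)^~ i @^-1` `[-1, 1]).
  apply/seteqP; split => x /= h i.
    by move=> _; rewrite /= in_itv /= -ler_norml.
  by have := h i I; rewrite /= in_itv /= -ler_norml.
apply: fin_bigcap_measurable => // i _; rewrite -[X in measurable X]setTI.
by apply: measurable_tnth => //; exact: measurable_itv.
Qed.

Definition uniform_cube n : {measure set (Rn R n) -> \bar R} :=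
  mscale ((2 ^+ n)^-1)%:nng (mrestr (@lebesgue_Rn n) (@measurable_cube n)).

End LebesgueRn.

Definition peval {R : realType} n (g : mpoly.mpoly n R) (x : Rn R n) : R :=
  mpoly.meval (tnth x) g.

Lemma measurable_peval (R : realType) n (g : mpoly.mpoly n R) :
  measurable_fun setT (peval g : Rn R n -> measurableTypeR R).
Proof.
rewrite /peval; under eq_fun do rewrite mpoly.mevalE.
apply: measurable_sum => m; apply: measurable_funM => //.
apply: measurable_prod => i _; apply: measurable_funX.
exact: measurable_tnth.
Qed.

Definition nu {R : realType} n (g : mpoly.mpoly n R) :
    {measure set (measurableTypeR R) -> \bar R} :=
  image_measure (@uniform_cube R n) (@measurable_peval R n g).

Section NuW.
Context {R : realType} (n : nat) (w : 'I_n -> nat) (m : nat).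

Definition wdeg : R := (\sum_i w i)%:R / m%:R.

Lemma wdeg_ge0 : 0 <= wdeg.
Proof. by rewrite divr_ge0. Qed.

(* If wdeg < 1, the value at t = 0 is 0 because of the convention on [powR];
   a null set. *)
Definition nu_w_pdf (t : R) : R := wdeg * t `^ (wdeg - 1).

Lemma nu_w_pdf_ge0 t : 0 <= nu_w_pdf t.
Proof. by rewrite mulr_ge0 ?wdeg_ge0 ?powR_ge0. Qed.

Lemma measurable_nu_w_pdf : measurable_fun setT nu_w_pdf.
Proof. by apply: measurable_funM => //; exact: measurable_powR. Qed.

Definition nu_w_set (A : set (measurableTypeR R)) : \bar R :=
  (\int[lebesgue_measure]_(t in A `&` `[0%R, 1%R]) (nu_w_pdf t)%:E)%E.

Let nu_w0 : nu_w_set set0 = 0%E.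
Proof. by rewrite /nu_w_set set0I integral_set0. Qed.

Let nu_w_ge0 A : (0 <= nu_w_set A)%E.
Proof. by apply: integral_ge0 => t _; rewrite lee_fin nu_w_pdf_ge0. Qed.

Let nu_w_sigma_additive : semi_sigma_additive nu_w_set.
Proof.
move=> /= F mF tF mUF; rewrite /nu_w_set setI_bigcupl; apply: cvg_toP.
  apply: ereal_nondecreasing_is_cvgn => p q pq.
  by apply: lee_sum_nneg_natr => // k _ _; exact: nu_w_ge0.
rewrite ge0_integral_bigcup//=.
- by move=> k; apply: measurableI => //; exact: measurable_itv.
- by apply: measurable_funTS; apply: measurableT_comp => //;
     exact: measurable_nu_w_pdf.
- by move=> x _; rewrite lee_fin nu_w_pdf_ge0.
- exact: trivIset_setIr.
Qed.

HB.instance Definition _ := isMeasure.Build _ _ _ nu_w_set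
  nu_w0 nu_w_ge0 nu_w_sigma_additive.

Definition nu_w : {measure set (measurableTypeR R) -> \bar R} := nu_w_set.

End NuW.
Arguments wdeg R {n} w m.
Arguments nu_w R {n} w m.

Section Bounds.
Context {R : realType}.

(* M_r(s), of size r + 1. *)
Definition moment_mx r (s : {measure set (measurableTypeR R) -> \bar R}) :
    'M[R]_r.+1 :=
  \matrix_(i, j) \int[s]_t (t ^+ (i + j)).

(* M_{r-1}(h s), of size r; the signed measure h s is only integrated. *)
Definition localizing_mx r (h : {poly R})
    (s : {measure set (measurableTypeR R) -> \bar R}) : 'M[R]_r :=
  \matrix_(i, j) \int[s]_t (h.[t] * t ^+ (i + j)).

(* The smallest real l such that det (A - l C) = 0, and 0 if there is none;
   it exists when A is symmetric, C symmetric positive definite, of size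
   k > 0. *)
Definition lambda_min k (A C : 'M[R]_k) : R :=
  xget 0 [set l | \det (A - l *: C) = 0 /\
                  forall l', \det (A - l' *: C) = 0 -> l <= l'].

Definition hpoly (gbar : R) : {poly R} := ('X - 1%:P) * (gbar%:P - 'X).

Definition v_plus n m (w : 'I_n -> nat) (g : mpoly.mpoly n R) (r : nat) : R :=
  2 ^+ n * lambda_min (moment_mx r (nu g)) (moment_mx r (nu_w R w m)).

Definition v_minus n m (w : 'I_n -> nat) (gbar : R) (g : mpoly.mpoly n R)
    (r : nat) : R :=
  - (2 ^+ n) * lambda_min (localizing_mx r (hpoly gbar) (nu g))
                          (- localizing_mx r (hpoly gbar) (nu_w R w m)).

End Bounds.

(* Main.v *)
(* The smallest generalized eigenvalue lambda_min A C is at most each Rayleigh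
   quotient (x A x^T) / (x C x^T); on moment matrices these quotients are
   ratios of integrals of squares p^2. By homogeneity of g, the measure nu
   coincides with l0 nu_w on [0, 1[, where l0 = nu [0, 1[. Hence a test
   polynomial p shows that the first eigenvalue exceeds l0 by at most
   (int_[1, gbar] p^2 d nu) / (int p^2 d nu_w), and similarly the second one
   exceeds - l0 by at most such a ratio weighted by h; the two l0 cancel.
   For p take the Chebyshev polynomial of [1, gbar]: it is bounded by 1 there,
   and at least (gamma (1 - t))^r / 2 on [0, 1], hence of order gamma^r on
   [0, 1/(2r)], an interval of nu_w-mass (2r)^(- |w|/m). *)
Require Import Defs.
From mathcomp Require Import all_boot all_order all_algebra.
From mathcomp Require Import all_classical all_reals all_analysis.
From mathcomp Require Import measurable_realfun.
From mathcomp Require Import ring lra.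
From mathcomp Require mpoly.

Set Implicit Arguments.
Unset Strict Implicit.
Unset Printing Implicit Defensive.

Import Order.TTheory GRing.Theory Num.Theory.
Import numFieldNormedType.Exports.

Local Open Scope classical_set_scope.
Local Open Scope ring_scope.

(** * Rayleigh quotients *)

Section Rayleigh.
Context {R : realType} {k : nat}.
Implicit Types (M A C : 'M[R]_k) (u v : 'rV[R]_k).

Definition bform M u v : R := (u *m M *m v^T) 0 0.
Definition qform M u : R := bform M u u.

Lemma bformDl M u1 u2 v : bform M (u1 + u2) v = bform M u1 v + bform M u2 v.
Proof. by rewrite /bform !mulmxDl mxE. Qed.

Lemma bformZl M a u v : bform M (a *: u) v = a * bform M u v.
Proof. by rewrite /bform -!scalemxAl mxE. Qed.

Lemma bform_tr M u v : bform M u v = bform M^T v u.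
Proof. by rewrite /bform -[u *m M *m v^T]trmxK mxE !trmx_mul trmxK mulmxA. Qed.

Lemma bformDr M u v1 v2 : bform M u (v1 + v2) = bform M u v1 + bform M u v2.
Proof. by rewrite bform_tr bformDl -!bform_tr. Qed.

Lemma bformZr M a u v : bform M u (a *: v) = a * bform M u v.
Proof. by rewrite bform_tr bformZl -bform_tr. Qed.

Lemma qformE M u : qform M u = \sum_i \sum_j u 0 i * u 0 j * M i j.
Proof.
rewrite /qform /bform mxE exchange_big /=; apply: eq_bigr => j _.
rewrite !mxE big_distrl /=; apply: eq_bigr => i _; ring.
Qed.

Lemma qformBZ A C l u : qform (A - l *: C) u = qform A u - l * qform C u.
Proof.
by rewrite /qform /bform mulmxBr mulmxBl -scalemxAr -scalemxAl !mxE.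
Qed.

(** The quadratic [t |-> qform M (u + t *: v)] is nonnegative; its minimum gives the inequality. As
    [M] is only semidefinite, [qform M v = 0] is a separate case. *)
Lemma bform_CauchySchwarz M u v : M^T = M -> (forall x, 0 <= qform M x) ->
  bform M u v ^+ 2 <= qform M u * qform M v.
Proof.
move=> sM pM.
have expand t : qform M (u + t *: v) =
    qform M u + 2 * t * bform M u v + t ^+ 2 * qform M v.
  rewrite /qform bformDl !bformDr !bformZl !bformZr (bform_tr M v u) sM.
  by ring.
have [v0|v0] := eqVneq (qform M v) 0.
  rewrite v0 mulr0.
  have [->|b0] := eqVneq (bform M u v) 0; first by rewrite expr0n.
  (* The quadratic is affine in [t] here; this [t] makes it equal to -1, so the linear coefficient
     must vanish. *)
  have := pM (u + (- (qform M u + 1) / (2 * bform M u v)) *: v).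
  rewrite expand v0 mulr0 addr0.
  rewrite (_ : _ + _ = -1); last by field.
  by rewrite oppr_ge0 ler10.
have v_gt0 : 0 < qform M v by rewrite lt_neqAle eq_sym v0 pM.
have := pM (u + (- bform M u v / qform M v) *: v).
rewrite expand -(pmulr_lge0 _ v_gt0).
rewrite [leRHS](_ : _ = qform M u * qform M v - bform M u v ^+ 2); last first.
  by field.
by rewrite subr_ge0.
Qed.

Definition sqnorm u : R := \sum_i u 0 i ^+ 2.

Lemma sqr_coord_le u i : u 0 i ^+ 2 <= sqnorm u.
Proof.
rewrite /sqnorm (bigD1 i)//= lerDl; apply: sumr_ge0 => j _.
exact: sqr_ge0.
Qed.

Lemma qform_norm_le M u : `|qform M u| <= (\sum_i \sum_j `|M i j|) * sqnorm u.
Proof.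
rewrite qformE big_distrl/= (le_trans (ler_norm_sum _ _ _))//.
apply: ler_sum => i _; rewrite big_distrl/= (le_trans (ler_norm_sum _ _ _))//.
apply: ler_sum => j _; rewrite normrM mulrC ler_wpM2l//.
(* The squares of [u_i + u_j] and [u_i - u_j] give [2 |u_i u_j| <= u_i^2 + u_j^2]. *)
have := sqr_coord_le u i; have := sqr_coord_le u j.
rewrite ler_norml; have := sqr_ge0 (u 0 i + u 0 j).
have := sqr_ge0 (u 0 i - u 0 j); nra.
Qed.

(* Cauchy-Schwarz for the form M, against the rows of the inverse of M. *)
Lemma psd_unit_coercive M : M^T = M -> (forall x, 0 <= qform M x) ->
  M \in unitmx -> exists2 K, 0 < K & forall u, sqnorm u <= K * qform M u.
Proof.
move=> sM pM uM.
(* The coordinate [u_i] equals [bform M u (row i (invmx M))]. *)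
have ipM i u : u 0 i ^+ 2 <= qform M u * qform M (row i (invmx M)).
  apply: le_trans (bform_CauchySchwarz u _ sM pM).
  by rewrite /bform tr_row trmx_inv sM colE mulmxA mulmxK// -colE mxE.
(* The summand 1 keeps the constant positive even when [k = 0]. *)
exists (1 + \sum_i qform M (row i (invmx M))) => [|u].
  by rewrite ltr_pwDl// sumr_ge0.
rewrite mulrDl mul1r big_distrl/=.
apply: (@le_trans _ _ (\sum_i qform M u * qform M (row i (invmx M)))).
  exact: ler_sum.
under [X in _ <= _ + X]eq_bigr do rewrite mulrC.
by rewrite lerDr.
Qed.

Lemma pd_unitmx M : (forall x, x != 0 -> 0 < qform M x) -> M \in unitmx.
Proof.
move=> pM; rewrite unitmxE unitfE; apply/det0P => -[v v0 vM].
by have := pM _ v0; rewrite /qform /bform vM mul0mx mxE ltxx.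
Qed.

Lemma lambda_min_Rayleigh A C u : A^T = A -> C^T = C ->
  (forall x, x != 0 -> 0 < qform C x) -> u != 0 ->
  lambda_min A C * qform C u <= qform A u.
Proof.
move=> sA sC pC u0.
pose S := [set qform A x / qform C x | x in [set x : 'rV_k | x != 0]].
have pC0 x : 0 <= qform C x.
  have [->|/pC/ltW//] := eqVneq x 0.
  by rewrite /qform /bform !mul0mx mxE.
have S0 : S !=set0 by exists (qform A u / qform C u), u.
(* Coercivity of [C] bounds [qform A] in absolute value by a multiple of [qform C]. *)
have lbS : has_lbound S.
  have [K K0 KC] := psd_unit_coercive sC pC0 (pd_unitmx pC).
  exists (- ((\sum_i \sum_j `|A i j|) * K)) => _ [x /= x0 <-].
  rewrite ler_pdivlMr ?pC// mulNr lerNl.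
  apply: (@le_trans _ _ `|qform A x|); first by rewrite lerNl lerNnormlW.
  apply: le_trans (qform_norm_le A x) _.
  rewrite -mulrA ler_wpM2l// sumr_ge0// => i _.
  exact: sumr_ge0.
have hiS : has_inf S by [].
have infP x : x != 0 -> inf S * qform C x <= qform A x.
  by move=> x0; rewrite -ler_pdivlMr ?pC//; apply: ge_inf => //; exists x.
pose M := A - inf S *: C.
have sM : M^T = M by rewrite /M linearB/= linearZ/= sA sC.
have pM x : 0 <= qform M x.
  have [->|x0] := eqVneq x 0; first by rewrite /qform /bform !mul0mx mxE.
  by rewrite qformBZ subr_ge0 infP.
have detM : \det M = 0.
  apply/eqP; case: eqP => // /eqP dM.
  have [K K0 KM] : exists2 K, 0 < K & forall x, sqnorm x <= K * qform M x.
    by apply: psd_unit_coercive => //; rewrite unitmxE unitfE.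
  pose L := 1 + \sum_i \sum_j `|C i j|.
  have L0 : 0 < L.
    by rewrite ltr_pwDl// sumr_ge0// => i _; exact: sumr_ge0.
  (* Since [qform C x <= L * sqnorm x <= L * K * qform M x], every quotient exceeds [inf S] by at
     least [(L * K)^-1]. *)
  have : inf S + (L * K)^-1 <= inf S.
    apply: lb_le_inf => // _ [x /= x0 <-].
    rewrite ler_pdivlMr ?pC// mulrDl -lerBrDl -qformBZ.
    rewrite mulrC ler_pdivrMr ?mulr_gt0// mulrCA mulrC.
    apply: le_trans (ler_norm _) _; apply: le_trans (qform_norm_le C x) _.
    apply: (@le_trans _ _ (L * sqnorm x)).
      by rewrite ler_wpM2r ?lerDr// sumr_ge0// => i _; exact: sqr_ge0.
    by rewrite [leRHS](_ : _ = L * (K * qform M x)) ?ler_pM2l//; ring.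
  by rewrite gerDl leNgt invr_gt0 mulr_gt0.
(* The default value 0 of [xget] does not occur: [inf S] is a smallest root, because a kernel vector
   of [A - l *: C] has Rayleigh quotient [l]. *)
rewrite /lambda_min; case: xgetP => [l -> [dl lmin]|].
  apply: le_trans (infP _ u0); rewrite ler_wpM2r//; exact: lmin.
move=> /(_ (inf S)) []; split=> // l /eqP/det0P[x x0].
move=> /(congr1 (fun y => (y *m x^T) 0 0)).
rewrite mul0mx [RHS]mxE -/(bform _ _ _) -/(qform _ _) qformBZ => /eqP.
rewrite subr_eq0 => /eqP lx; rewrite -(ler_pM2r (pC _ x0)) -lx.
exact: infP.
Qed.

End Rayleigh.

(** * Chebyshev polynomials *)

Section Chebyshev.
Context {R : realType}.

(* T and U are the Chebyshev polynomials (T_k, U_(k-1)) composed with y; the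
   last clause is de Moivre's formula with s in the role of i * sin. *)
Lemma Chebyshev_pair (y : {poly R}) k : (size y <= 2)%N ->
  exists T U : {poly R}, [/\ (size T <= k.+1)%N, (size U <= k)%N,
    T ^+ 2 + (1 - y ^+ 2) * U ^+ 2 = 1 &
    forall t s, s ^+ 2 = y.[t] ^+ 2 - 1 ->
      T.[t] + s * U.[t] = (y.[t] + s) ^+ k].
Proof.
move=> sy; elim: k => [|k [T [U [sT sU TU deM]]]].
  exists 1, 0; split; rewrite ?size_poly1 ?size_poly0//; first by ring.
  by move=> t s _; rewrite !hornerE.
have sz1y : (size (1 - y ^+ 2)%R <= 3)%N.
  rewrite (leq_trans (size_polyD _ _))// geq_max size_poly1 size_polyN/=.
  rewrite expr2 (leq_trans (size_polyMleq _ _))// -subn1 leq_subLR.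
  exact: (leq_add sy sy).
(* Expansion of [(T + s U) (y + s)] with [s^2 = y^2 - 1]. *)
exists (y * T - (1 - y ^+ 2) * U), (T + y * U); split.
- rewrite (leq_trans (size_polyD _ _))// geq_max size_polyN; apply/andP; split.
    by rewrite (leq_trans (size_polyMleq _ _))// -subn1 leq_subLR (leq_add sy).
  by rewrite (leq_trans (size_polyMleq _ _))// -subn1 leq_subLR (leq_add sz1y).
- rewrite (leq_trans (size_polyD _ _))// geq_max sT/=.
  by rewrite (leq_trans (size_polyMleq _ _))// -subn1 leq_subLR (leq_add sy).
- by rewrite -[RHS]TU; ring: TU.
- move=> t s st; rewrite (exprS (y.[t] + s)) -deM// !hornerE.
  by ring: st.
Qed.

(** The affine [y] decreases from 1 to -1 on [[1, G]], and [p] is [T_k] composed with [y]. On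
    [[1, G]] the Pell identity bounds [p^2] by 1. On [[0, 1]], [p] is half the sum of [(y + s)^k]
    and [(y - s)^k] with [s = sqrt (y^2 - 1)]; the second power is nonnegative, and
    [y + s >= gamma (1 - t)]. *)
Lemma Chebyshev_test_poly (G : R) k : 1 < G ->
  let gamma := (Num.sqrt G + 1) / (Num.sqrt G - 1) in
  exists p : {poly R}, [/\ (size p <= k.+1)%N,
    forall t, 1 <= t <= G -> p.[t] ^+ 2 <= 1 &
    forall t, 0 <= t <= 1 -> (gamma * (1 - t)) ^+ k / 2 <= p.[t]].
Proof.
move=> G1 /=; set q := Num.sqrt G.
have G0 : 0 < G by exact: lt_trans G1.
have qE : q ^+ 2 = G by rewrite sqr_sqrtr// ltW.
have q1 : 1 < q by rewrite -sqrtr1 ltr_sqrt.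
pose y : {poly R} := ((G + 1) / (G - 1))%:P - (2 / (G - 1)) *: 'X.
have yE t : y.[t] = (G + 1 - 2 * t) / (G - 1).
  by rewrite /y !hornerE; field; lra.
have sy : (size y <= 2)%N.
  rewrite (leq_trans (size_polyD _ _))// geq_max size_polyN.
  rewrite (leq_trans (size_polyC_leq1 _))//=.
  by rewrite (leq_trans (size_scale_leq _ _))// size_polyX.
clearbody y; have [T [U [sT sU TU deM]]] := Chebyshev_pair k sy.
exists T; split=> // t /andP[t0 t1].
  have pell : T.[t] ^+ 2 + (1 - y.[t] ^+ 2) * U.[t] ^+ 2 = 1.
    by have := congr1 (fun p => p.[t]) TU; rewrite !hornerE.
  rewrite -pell lerDl mulr_ge0//; last exact: sqr_ge0.
  rewrite subr_ge0 -[_ ^+ 2]ger0_norm ?sqr_ge0// normrX expr_le1// yE.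
  rewrite normrM normfV [X in _ / X]gtr0_norm ?subr_gt0//.
  rewrite ler_pdivrMr ?subr_gt0// mul1r ler_norml.
  by apply/andP; split; lra.
(* This is [y^2 - 1] at [t], in factored form. *)
pose D := 4 * (G - t) * (1 - t) / (G - 1) ^+ 2.
have D0 : 0 <= D.
  by rewrite divr_ge0 ?sqr_ge0// !mulr_ge0// subr_ge0// (le_trans t1)// ltW.
have sE : Num.sqrt D ^+ 2 = y.[t] ^+ 2 - 1.
  by rewrite sqr_sqrtr// /D yE; field; lra.
(* De Moivre's formula at [s] and at [- s]; the sum eliminates [U]. *)
have e1 := deM _ _ sE.
have e2 := deM t (- Num.sqrt D); rewrite sqrrN in e2; have {}e2 := e2 sE.
have s0 : 2 * q * (1 - t) / (G - 1) <= Num.sqrt D.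
  have c0 : 0 <= 2 * q * (1 - t) / (G - 1).
    by rewrite divr_ge0 ?mulr_ge0//; lra.
  rewrite -[leLHS](ger0_norm c0) -sqrtr_sqr ler_wsqrtr// /D.
  rewrite expr_div_n ler_wpM2r ?invr_ge0 ?sqr_ge0// !exprMn qE.
  have : G * (1 - t) <= G - t by nra.
  move=> /(@ler_wpM2r _ (4 * (1 - t))); nra.
have y0 : (G + 1) * (1 - t) / (G - 1) <= y.[t].
  rewrite yE ler_pM2r ?invr_gt0 ?subr_gt0//; nra.
have y_ge0 : 0 <= y.[t].
  by apply: le_trans y0; rewrite divr_ge0 ?mulr_ge0//; lra.
have D_le : Num.sqrt D <= y.[t].
  rewrite -[leRHS](ger0_norm y_ge0) -sqrtr_sqr ler_wsqrtr//.
  by move: sE; rewrite sqr_sqrtr//; lra.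
(* So [gamma] is the value of [y + sqrt D] at [t = 0]. *)
have gE : (q + 1) / (q - 1) = (G + 1) / (G - 1) + 2 * q / (G - 1).
  by rewrite -qE; field; apply/andP; split; nra.
have z0 : (q + 1) / (q - 1) * (1 - t) <= y.[t] + Num.sqrt D.
  rewrite gE; apply: le_trans (lerD y0 s0); lra.
have : ((q + 1) / (q - 1) * (1 - t)) ^+ k <= (y.[t] + Num.sqrt D) ^+ k.
  by rewrite lerXn2r// nnegrE ?addr_ge0 ?sqrtr_ge0// mulr_ge0 ?divr_ge0//; lra.
have : 0 <= (y.[t] - Num.sqrt D) ^+ k by rewrite exprn_ge0// subr_ge0.
lra.
Qed.

End Chebyshev.

(** * Dilations of Lebesgue measure *)

Section LebesgueScaling.
Context {R : realType}.
Local Notation mu := (@lebesgue_measure R).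

(** The image of Lebesgue measure under multiplication by [c], scaled by [c], gives each []a, b]]
    its length, so uniqueness identifies it with Lebesgue measure. *)
Lemma lebesgue_measure_dilation (c : R) (A : set (measurableTypeR R)) :
  0 < c -> measurable A -> (c%:E * mu ( *%R c @^-1` A) = mu A)%E.
Proof.
move=> c0 mA; apply/esym.
have mc : measurable_fun setT ( *%R c : measurableTypeR R -> measurableTypeR R).
  exact: measurable_funM.
pose m' := mscale (NngNum (ltW c0)) (image_measure mu mc).
rewrite (lebesgue_measure_unique (mu := m'))// => _ [[a b] _ <-].
rewrite [RHS](_ : _ = c%:E * mu ( *%R c @^-1` `]a, b]%classic))%E//.
have -> : *%R c @^-1` `]a, b]%classic = `]a / c, b / c]%classic.
  apply/seteqP; split=> x /=; rewrite !in_itv/=;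
  by rewrite ltr_pdivrMr// ler_pdivlMr// mulrC.
rewrite !lebesgue_measure_itv/= !lte_fin ltr_pM2r ?invr_gt0//.
case: ifPn => _; last by rewrite mule0.
by rewrite -!EFinB -EFinM; congr EFin; field; rewrite gt_eqF.
Qed.

Definition dilation n (c : 'I_n -> R) (x : Rn R n) : Rn R n :=
  [tuple c i * tnth x i | i < n].

Lemma measurable_dilation n (c : 'I_n -> R) : measurable_fun setT (dilation c).
Proof.
apply/measurable_fun_tnthP => i.
rewrite (_ : _ \o _ = fun x => c i * tnth x i); last first.
  by apply/funext => x; rewrite /= tnth_mktuple.
by apply: measurable_funM => //; exact: measurable_tnth.
Qed.

Lemma dilation_cons n (c : 'I_n.+1 -> R) p :
  dilation c (tuple_cons p) =
  tuple_cons (c ord0 * p.1, dilation (c \o lift ord0) p.2).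
Proof.
apply: eq_from_tnth => i; rewrite tnth_mktuple.
case: (unliftP ord0 i) => [j|] ->; last by rewrite !tnth0.
by rewrite !tnthS tnth_mktuple.
Qed.

(** Induction on [n]: through [tuple_cons] the dilation acts separately on the first coordinate and
    on the rest, and a measure with the right values on rectangles is the product measure. *)
Lemma lebesgue_Rn_dilation n (c : 'I_n -> R) (A : set (Rn R n)) :
  (forall i, 0 < c i) -> measurable A ->
  ((\prod_i c i)%:E * lebesgue_Rn n (dilation c @^-1` A) = lebesgue_Rn n A)%E.
Proof.
elim: n c A => [|n IH] c A c0 mA.
  rewrite big_ord0 mul1e; congr (_ _); apply/seteqP; split=> x/=;
  by rewrite (tuple0 (dilation c x)) (tuple0 x).
pose d (p : measurableTypeR R * Rn R n) : measurableTypeR R * Rn R n :=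
  (c ord0 * p.1, dilation (c \o lift ord0) p.2).
have md : measurable_fun setT d.
  apply: measurable_fun_pair; first exact: measurable_funM.
  by apply: measurableT_comp => //; exact: measurable_dilation.
have k0 : 0 <= \prod_i c i by apply: prodr_ge0 => i _; exact: ltW.
pose m' := mscale (NngNum k0) (image_measure (mu \x lebesgue_Rn n)%E md).
have m'E B :
  m' B = ((\prod_i c i)%:E * (mu \x lebesgue_Rn n) (d @^-1` B))%E by [].
have mtA : measurable (@tuple_cons R n @^-1` A).
  by rewrite -[X in measurable X]setTI; exact: measurable_tuple_cons.
transitivity (m' (@tuple_cons R n @^-1` A)).
  rewrite m'E; congr (_ * _)%E.
  transitivity ((mu \x lebesgue_Rn n)%E
    (@tuple_cons R n @^-1` (dilation c @^-1` A))).
    by [].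
  congr (_ _); apply/funext => p.
  by rewrite /preimage/= dilation_cons.
apply: esym; apply: (product_measure_unique (m' := m')) mtA => X Y mX mY.
apply: etrans (m'E _) _.
have -> : d @^-1` (X `*` Y) =
  ( *%R (c ord0) @^-1` X) `*` (dilation (c \o lift ord0) @^-1` Y) by [].
have mX' : measurable ( *%R (c ord0) @^-1` X : set (measurableTypeR R)).
  rewrite -[X in measurable X]setTI.
  by apply: (measurable_funM (f := cst (c ord0)) (g := id)).
have mY' : measurable (dilation (c \o lift ord0) @^-1` Y).
  by rewrite -[X in measurable X]setTI; exact: measurable_dilation.
rewrite product_measure1E// big_ord_recl EFinM.
rewrite muleACA; congr (_ * _)%E; first exact: lebesgue_measure_dilation.
by have := IH (c \o lift ord0) Y (fun i => c0 (lift ord0 i)) mY.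
Qed.

Lemma lebesgue_Rn_cube n : lebesgue_Rn n (@cube R n) = (2 ^+ n)%:E.
Proof.
elim: n => [|n IH].
  by rewrite /= diracE mem_set// => -[].
have cubeS : @tuple_cons R n @^-1` @cube R n.+1 = `[-1, 1] `*` @cube R n.
  apply/seteqP; split=> -[a x] /=.
    move=> h; split; first by have := h ord0; rewrite tnth0 in_itv/= -ler_norml.
    by move=> i; have := h (lift ord0 i); rewrite tnthS.
  move=> [/= a1 h] i; case: (unliftP ord0 i) => [j|] ->.
    by rewrite tnthS.
  by rewrite tnth0 ler_norml; move: a1; rewrite in_itv.
transitivity ((mu \x lebesgue_Rn n)%E (`[-1, 1] `*` @cube R n)).
  by rewrite -cubeS.
rewrite product_measure1E//; last exact: measurable_cube.
transitivity (mu `[(-1)%R, 1%R] * (2 ^+ n)%:E)%E; first by congr (_ * _)%E.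
rewrite lebesgue_measure_itv/= lte_fin ifT; last lra.
by rewrite -EFinB -EFinM exprS opprK.
Qed.

End LebesgueScaling.

(** * The measures nu_w and nu *)

Section NuWeighted.
Context {R : realType} (n : nat) (w : 'I_n -> nat) (m : nat).
Local Notation mu := (@lebesgue_measure R).
Local Notation alpha := (wdeg R w m).
Local Notation nuw := (nu_w R w m).

Lemma nu_wE A :
  nuw A = (\int[mu]_(t in A `&` `[0%R, 1%R]) (nu_w_pdf w m t)%:E)%E.
Proof. by []. Qed.

Lemma nu_w_null (a : R) (A : set (measurableTypeR R)) :
  A `&` `[0, 1] `<=` [set a] -> nuw A = 0%E.
Proof. by move=> A1; rewrite nu_wE; exact: integral_Sset1 A1. Qed.

(** [t^alpha] is an antiderivative of the density; [0 < a] avoids the point 0, where the density may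
    be unbounded. *)
Lemma nu_w_itvcc (a b : R) : 0 < a -> a <= b -> b <= 1 ->
  nuw `[a, b]%classic = (b `^ alpha - a `^ alpha)%:E.
Proof.
rewrite le_eqVlt => a0 /predU1P[<-{b} _|ab b1].
  by rewrite set_itv1 subrr; apply: (nu_w_null (a := a)); exact: subIsetl.
rewrite nu_wE setIidl; last first.
  by move=> x /=; rewrite !in_itv/=; lra.
have gt0 x : a <= x -> 0 < x by exact: lt_le_trans.
have cpow (p x : R) : 0 < x -> {for x, continuous (fun t => t `^ p)}.
  move=> x0; apply: differentiable_continuous; apply/derivable1_diffP.
  by apply: derivable_powR; rewrite in_itv/= x0.
rewrite (@continuous_FTC2 _ (nu_w_pdf w m) (fun t => t `^ alpha))//.
- apply: continuous_in_subspaceT => x.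
  rewrite inE/= in_itv/= => /andP[/gt0 x0 _].
  by apply: cvgM; [exact: cvg_cst|exact: cpow].
- split.
  + move=> x; rewrite in_itv/= => /andP[/ltW/gt0 x0 _].
    by apply: derivable_powR; rewrite in_itv/= x0.
  + by apply: cvg_at_right_filter; exact: cpow.
  + by apply: cvg_at_left_filter; apply: cpow; exact: lt_trans ab.
- move=> x; rewrite in_itv/= => /andP[/ltW/gt0 x0 _].
  by rewrite powR_derive1// in_itv/= x0.
Qed.

(** Continuity from below along the intervals [[t / (k + 1), t]], which increase to []0, t]], while
    [(t / (k + 1))^alpha] tends to 0. *)
Lemma nu_w_itvoc (t : R) : 0 < alpha -> 0 < t <= 1 ->
  nuw `]0, t]%classic = (t `^ alpha)%:E.
Proof.
move=> al0 /andP[t0 t1].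
pose F k : set (measurableTypeR R) := `[t * harmonic k, t]%classic.
have u0 k : 0 < t * harmonic k by rewrite mulr_gt0// harmonic_gt0.
have Fk k : nuw (F k) = (t `^ alpha - (t * harmonic k) `^ alpha)%:E.
  rewrite nu_w_itvcc//.
  by apply: ler_piMr; [exact: ltW|rewrite /= invf_le1// ler1n].
have UF : \bigcup_k F k = `]0, t]%classic.
  apply/seteqP; split=> x /=.
    move=> [k _]; rewrite /F/= !in_itv/= => /andP[kx ->].
    by rewrite (lt_le_trans (u0 k)).
  rewrite in_itv/= => /andP[x0 xt].
  exists (Num.bound (t / x)) => //; rewrite /F/= in_itv/= xt andbT.
  rewrite /= ler_pdivrMr// mulrC -ler_pdivrMr// ltW//.
  apply: lt_trans (archi_boundP _) _; last by rewrite ltr_nat.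
  by rewrite divr_ge0// ltW.
have ndF : nondecreasing_seq F.
  move=> i j ij; apply/subsetPset => x; rewrite /F/= !in_itv/= => /andP[ix ->].
  rewrite andbT; apply: le_trans ix; rewrite ler_pM2l//.
  by rewrite /= lef_pV2 ?posrE// ler_nat.
have cF : nuw \o F @ \oo --> nuw `]0, t]%classic.
  have mF k : measurable (F k) by exact: measurable_itv.
  rewrite -UF; apply: nondecreasing_cvg_mu => //.
  exact: bigcupT_measurable.
have cu : (t * harmonic k) @[k --> \oo] --> (0 : R).
  by rewrite -[X in _ --> X](mulr0 t); apply: cvgMr; exact: cvg_harmonic.
apply: cvg_unique cF _ => //.
rewrite (_ : nuw \o F =
    EFin \o (fun k => t `^ alpha - (t * harmonic k) `^ alpha)); last first.
  by apply/funext => k /=; rewrite Fk.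
apply: cvg_EFin; first exact: nearW.
rewrite -[X in _ --> X]subr0; apply: cvgB; first exact: cvg_cst.
by have /cvg_at_rightP := powR_cvg0 al0; apply.
Qed.

Lemma nu_w_itvNyo (t : R) : 0 < alpha -> 0 < t <= 1 ->
  nuw `]-oo, t[%classic = (t `^ alpha)%:E.
Proof.
move=> al0 t01; have /andP[t0 t1] := t01; rewrite -nu_w_itvoc//.
have -> : `]-oo, t[%classic = `]0, t[ `|` `]-oo, 0] :> set R.
  apply/seteqP; split=> x /=; rewrite !in_itv/=; last by case; lra.
  by move=> ->; have [|] := ltP 0 x; [left|right].
have -> : `]0, t]%classic = `]0, t[ `|` [set t] :> set R.
  by rewrite setUitv1.
have m1 a : measurable ([set a] : set (measurableTypeR R)) by [].
rewrite [RHS]measureU0//; last by apply: (nu_w_null (a := t)); exact: subIsetl.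
rewrite measureU0//; apply: (nu_w_null (a := 0)) => x /=.
by rewrite !in_itv/=; lra.
Qed.

Lemma nu_w_itvco (t : R) : 0 < alpha -> 0 < t <= 1 ->
  nuw `[0, t[%classic = (t `^ alpha)%:E.
Proof.
move=> al0 t01; rewrite -nu_w_itvNyo//.
have -> : `]-oo, t[%classic = `[0, t[ `|` `]-oo, 0[ :> set R.
  apply/seteqP; split=> x /=; rewrite !in_itv/=; last by case; lra.
  by move=> ->; have [|] := leP 0 x; [left|right].
rewrite [RHS]measureU0//; apply: (nu_w_null (a := 0)) => x /=.
by rewrite !in_itv/=; lra.
Qed.

Lemma nu_w_finite (Z : set (measurableTypeR R)) : finite_set Z -> nuw Z = 0%E.
Proof.
move=> fZ; rewrite nu_wE.
have fZ1 : finite_set (Z `&` `[0%R, 1%R]) by exact: finite_setIl.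
apply: null_set_integral.
- apply: countable_measurable; last exact: finite_set_countable.
  by move=> t; exact: measurable_set1.
- apply: measurable_funTS; apply/measurable_EFinP.
  exact: measurable_nu_w_pdf.
- by apply: countable_lebesgue_measure0; exact: finite_set_countable.
Qed.

Lemma nu_w_full (A : set (measurableTypeR R)) : 0 < alpha -> measurable A ->
  `]-oo, 1[%classic `<=` A -> nuw A = 1%E.
Proof.
move=> al0 mA A1; rewrite -(setDUK A1) measureU0//.
- by rewrite nu_w_itvNyo ?powR1// ltr01 lexx.
- exact: measurableD.
- apply: (nu_w_null (a := 1)) => x /=; rewrite !in_itv/= => -[[_ /negP]].
  by rewrite -leNgt; lra.
Qed.

End NuWeighted.

(** * The distribution of [g] below level 1 *)

Section NuDistribution.
Context {R : realType} (n m : nat) (w : 'I_n -> nat) (g : mpoly.mpoly n R).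
Local Notation alpha := (wdeg R w m).
Local Notation halfline t := (`]-oo, t%R[%classic : set (measurableTypeR R)).

Lemma nuE (A : set (measurableTypeR R)) :
  nu g A = ((2 ^+ n)^-1%:E * lebesgue_Rn n (peval g @^-1` A `&` @cube R n))%E.
Proof. by []. Qed.

Lemma nu_compl (A : set (measurableTypeR R)) :
  (forall x, cube x -> ~ A (peval g x)) -> nu g A = 0%E.
Proof.
move=> gA; rewrite nuE (_ : _ `&` _ = set0) ?measure0 ?mule0//.
by apply/seteqP; split=> x //= [Agx /gA].
Qed.

Lemma nu_setT : nu g setT = 1%E.
Proof.
by rewrite nuE preimage_setT setTI lebesgue_Rn_cube -EFinM mulVf.
Qed.

Hypothesis m_gt0 : (0 < m)%N.
Hypothesis g_homo : forall (t : R) (x : Rn R n), 0 < t ->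
  peval g [tuple t ^+ w i * tnth x i | i < n] = t ^+ m * peval g x.
Hypothesis g_sublevel : [set x | peval g x <= 1] `<=` cube (n := n).

(** With [s = t^(1/m)], homogeneity makes [{g < t}] the image of [{g < 1}] under the dilation with
    factors [s^(w i)], whose Jacobian is [s^|w| = t^alpha]. Both sets lie in the cube, so
    intersecting with it changes nothing. *)
Lemma nu_halfline t : 0 < t <= 1 ->
  nu g (halfline t) = ((t `^ alpha)%:E * nu g (halfline 1))%E.
Proof.
move=> /andP[t0 t1].
have subcube (u : R) : u <= 1 ->
    peval g @^-1` (halfline u) `&` @cube R n = peval g @^-1` (halfline u).
  move=> u1; apply: setIidl => x /=; rewrite in_itv/= => gu.
  by apply: g_sublevel => /=; apply: le_trans u1; exact: ltW.
rewrite !nuE !subcube// muleCA; congr (_ * _)%E.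
pose s := t `^ m%:R^-1.
have s0 : 0 < s by rewrite powR_gt0.
have sm : s ^+ m = t.
  rewrite -powR_mulrn ?powR_ge0// -powRrM mulVf ?powRr1 ?ltW//.
  by rewrite pnatr_eq0 -lt0n.
have mpre : measurable (peval g @^-1` halfline t).
  by rewrite -[X in measurable X]setTI; apply: measurable_peval.
rewrite -(lebesgue_Rn_dilation (c := fun i => s ^+ w i)) => [|i|//]; last first.
  exact: exprn_gt0.
congr (_%:E * _)%E.
  rewrite prodrXr -powR_mulrn ?powR_ge0// -powRrM; congr (_ `^ _).
  by rewrite mulrC.
congr (_ _); apply/seteqP; split=> x /=;
  rewrite !in_itv/= /dilation g_homo// sm.
  by rewrite gtr_pMr.
by rewrite gtr_pMr.
Qed.

Hypothesis g_ge0 : forall x : Rn R n, 0 <= peval g x.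
Hypothesis alpha_gt0 : 0 < alpha.

(** Open half-lines are stable under intersection and generate the Borel sets, so it suffices to
    compare the two finite measures on them. *)
Lemma nu_eq_nu_w A : measurable A -> A `<=` halfline 1 ->
  nu g A = (nu g (halfline 1) * nu_w R w m A)%E.
Proof.
have fin1 : nu g (halfline 1) \is a fin_num.
  rewrite ge0_fin_numE//; apply: (@le_lt_trans _ _ (nu g setT)).
    by apply: le_measure; rewrite ?inE//; exact: measurable_itv.
  by rewrite nu_setT ltry.
have k0 : 0 <= fine (nu g (halfline 1)) by rewrite fine_ge0.
move=> mA A1; have mh t : measurable (halfline t) by exact: measurable_itv.
rewrite -[X in (X * _)%E]fineK//.
rewrite -[LHS]/(nu g A) -[in LHS](setIidl A1).
pose m1 := mrestr (nu g) (mh 1); pose m2 := mscale (NngNum k0) (nu_w R w m).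
suff : m1 A = m2 A by [].
refine (@measure_unique _ R (measurableTypeR R) (@RGenInftyO.G R)
  (fun k => halfline k%:R) _ _ _ _ m1 m2 _ _ A mA).
- exact: RGenInftyO.measurableE.
- move=> _ _ [a ->] [b ->]; exists (Num.min a b).
  apply/seteqP; split=> x /=; rewrite !in_itv/= lt_min; first by move=> [-> ->].
  by move=> /andP.
- by move=> k; exists k%:R.
- rewrite -subTset => x _; exists (Num.bound `|x|) => //=; rewrite in_itv/=.
  by apply: le_lt_trans (ler_norm _) _; exact/archi_boundP/normr_ge0.
- move=> _ [t ->].
  rewrite -[LHS]/(nu g (halfline t `&` halfline 1)).
  rewrite -[RHS]/((fine (nu g (halfline 1)))%:E *
    nu_w R w m (halfline t))%E fineK//.
  (* For [t <= 0] both sides vanish, for [0 < t <= 1] homogeneity applies, and for [t > 1] both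
     sides are the full mass. *)
  have [t0|t0] := leP t 0.
    rewrite (nu_w_null w m (a := 0)) ?mule0; last first.
      by move=> x /=; rewrite !in_itv/=; lra.
    apply: nu_compl => x _ /=; rewrite !in_itv/= => -[].
    by have := g_ge0 x; lra.
  have [t1|t1] := leP t 1.
    have t01 : 0 < t <= 1 by rewrite t0.
    rewrite setIidl; last by move=> x /=; rewrite !in_itv/=; lra.
    by rewrite (nu_halfline t01) (nu_w_itvNyo alpha_gt0 t01) muleC.
  rewrite setIidr; last by move=> x /=; rewrite !in_itv/=; lra.
  by rewrite nu_w_full ?mule1// => x /=; rewrite !in_itv/=; lra.
- move=> k; apply: le_lt_trans (_ : nu g setT < +oo)%E; last first.
    by rewrite nu_setT ltry.
  by apply: le_measure; rewrite ?inE//; exact: measurableI.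
Qed.

End NuDistribution.

(** * Integrals of polynomials and moment matrices *)

Section PolynomialIntegral.
Context {R : realType}.
Variables (s : {measure set (measurableTypeR R) -> \bar R}) (M : R).
Hypothesis s_fin : (s setT < +oo)%E.
Hypothesis s_supp : s (~` `[0%R, M]%classic) = 0%E.
Implicit Types (p q h : {poly R}) (D : set (measurableTypeR R)).

(** A polynomial is bounded on the compact [[0, M]], whose complement is null for the finite measure
    [s]. *)
Lemma integrable_horner p D :
  measurable D -> s.-integrable D (EFin \o horner p).
Proof.
move=> mD; apply: (@integrableS _ _ _ _ setT) => //.
have mp : measurable_fun setT (EFin \o horner p : measurableTypeR R -> \bar R).
  apply/measurable_EFinP; apply: continuous_measurable_fun.
  exact: continuous_horner.
have mI : measurable (`[0%R, M]%classic : set (measurableTypeR R)).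
  exact: measurable_itv.
apply/(negligible_integrable (measurableC mI) measurableT mp s_supp).
rewrite setTD setCK; apply: measurable_bounded_integrable => //.
- by apply: le_lt_trans s_fin; apply: le_measure; rewrite ?inE.
- apply: measurable_funTS; apply: continuous_measurable_fun.
  exact: continuous_horner.
- have /compact_bounded : compact (horner p @` `[0%R, M]%classic).
    apply: continuous_compact; last exact: segment_compact.
    by apply: continuous_subspaceT; exact: continuous_horner.
  move=> [B [Br hB]]; exists B; split=> // x xB t It.
  by apply: hB => //; exists t.
Qed.

Definition pint p : R := \int[s]_t p.[t].

Lemma pintD p q : pint (p + q) = pint p + pint q.
Proof.
rewrite /pint -RintegralD//; try exact: integrable_horner.
by apply: eq_Rintegral => t _; rewrite hornerD.
Qed.

Lemma pintZ a p : pint (a *: p) = a * pint p.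
Proof.
rewrite /pint -RintegralZl//; try exact: integrable_horner.
by apply: eq_Rintegral => t _; rewrite hornerZ.
Qed.

Lemma pint_sum k (F : 'I_k -> {poly R}) : pint (\sum_i F i) = \sum_i pint (F i).
Proof.
apply: (big_morph _ pintD).
by rewrite -(scale0r 0) pintZ mul0r.
Qed.

Lemma localizing_mx_tr k h : (localizing_mx k h s)^T = localizing_mx k h s.
Proof. by apply/matrixP => i j; rewrite !mxE addnC. Qed.

Lemma localizing_mxE k h i j :
  localizing_mx k h s i j = pint (h * 'X^(i + j)).
Proof.
by rewrite mxE; apply: eq_Rintegral => t _; rewrite hornerM hornerXn.
Qed.

Lemma localizing_mxN k h : - localizing_mx k h s = localizing_mx k (- h) s.
Proof.
apply/matrixP => i j; rewrite mxE !localizing_mxE -mulN1r -pintZ.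
by rewrite scaleN1r mulNr.
Qed.

(** Lets both eigenvalue bounds come from one statement on localizing matrices; the index of
    [moment_mx] is a degree, that of [localizing_mx] a size. *)
Lemma moment_mx_localizing r : moment_mx r s = localizing_mx r.+1 1 s.
Proof.
apply/matrixP => i j; rewrite !mxE; apply: eq_Rintegral => t _.
by rewrite hornerC mul1r.
Qed.

Lemma qform_localizing k h (u : 'rV[R]_k) :
  qform (localizing_mx k h s) u = pint (h * rVpoly u ^+ 2).
Proof.
have -> : rVpoly u = \sum_i u 0 i *: 'X^i.
  rewrite /rVpoly poly_def; apply: eq_bigr => i _; rewrite insubT// => *.
  by congr (u 0 _ *: _); exact: val_inj.
rewrite qformE expr2 big_distrlr big_distrr/= pint_sum; apply: eq_bigr => i _.
rewrite big_distrr/= pint_sum; apply: eq_bigr => j _.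
rewrite localizing_mxE -pintZ; congr pint.
by rewrite exprD -!mul_polyC polyCM; ring.
Qed.

End PolynomialIntegral.

(** * Positivity and lower bounds for integrals against [nu_w] *)

Section MomentComparison.
Context {R : realType}.
Implicit Types (f p : {poly R}).

Lemma finite_roots p : p != 0 -> finite_set [set x | root p x].
Proof.
move=> p0; apply: contrapT => infZ.
have [B BZ] := infinite_set_fset (size p) infZ.
rewrite leqNgt => /negP; apply; apply: max_poly_roots => //.
  by apply/allP => x /BZ.
exact: finmap.fset_uniq.
Qed.

Lemma pint_restrict (s : {measure set (measurableTypeR R) -> \bar R}) M f D :
  (s setT < +oo)%E -> s (~` `[0, M]%classic) = 0%E ->
  measurable D -> s (~` D) = 0%E ->
  pint s f = \int[s]_(t in D) f.[t].
Proof.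
move=> sfin s0 mD sD; rewrite /pint /Rintegral.
rewrite (negligible_integral (measurableC mD)) ?setTD ?setCK//.
exact: (integrable_horner sfin s0).
Qed.

Context (n m : nat) (w : 'I_n -> nat).
Hypothesis alpha_gt0 : 0 < wdeg R w m.
Local Notation alpha := (wdeg R w m).
Local Notation nuw := (nu_w R w m).

Let nuw_fin : (nuw setT < +oo)%E.
Proof. by rewrite nu_w_full// ltry. Qed.

Let nuw_supp : nuw (~` `[0, 1]%classic) = 0%E.
Proof. by apply: (nu_w_null w m (a := 0)) => x []. Qed.

Let mcc a b : measurable (`[a, b]%classic : set (measurableTypeR R)).
Proof. exact: measurable_itv. Qed.

Let mco a b : measurable (`[a, b[%classic : set (measurableTypeR R)).
Proof. exact: measurable_itv. Qed.

Lemma pint_nu_w_ge0 f : (forall t, 0 <= t <= 1 -> 0 <= f.[t]) ->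
  0 <= pint nuw f.
Proof.
move=> f0; rewrite (pint_restrict f nuw_fin nuw_supp (mcc 0 1))//.
by apply: Rintegral_ge0 => t; exact: f0.
Qed.

(** If the integral vanished, [f] would be zero almost everywhere on [[0, 1]]; but its roots are
    finitely many, hence null, while [nu_w] has mass 1. *)
Lemma pint_nu_w_gt0 f : f != 0 -> (forall t, 0 <= t <= 1 -> 0 <= f.[t]) ->
  0 < pint nuw f.
Proof.
move=> fn0 f0; rewrite lt_neqAle pint_nu_w_ge0// andbT eq_sym.
apply/negP => /eqP.
rewrite (pint_restrict f nuw_fin nuw_supp (mcc 0 1))// => If0.
have intf := integrable_horner nuw_fin nuw_supp f (mcc 0 1).
have : (\int[nuw]_(t in `[0%R, 1%R]) `|(f.[t])%:E| = 0)%E.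
  transitivity (\int[nuw]_(t in `[0%R, 1%R]) (f.[t])%:E)%E; last first.
    by rewrite -[LHS]fineK ?[fine _]If0//; exact: integrable_fin_num.
  by apply: eq_integral => t /set_mem t01; rewrite gee0_abs// lee_fin f0.
move=> /(ae_eq_integral_abs _ (mcc 0 1) (measurable_int _ intf))[N [mN N0 fN]].
have fZ := finite_roots fn0.
have mZ : measurable ([set x | root f x] : set (measurableTypeR R)).
  apply: countable_measurable; last exact: finite_set_countable.
  by move=> t; exact: measurable_set1.
have : (nuw setT <= nuw (N `|` [set x | root f x] `|` ~` `[0%R, 1%R]%classic))%E.
  apply: le_measure; rewrite ?inE//.
    by apply: measurableU; [exact: measurableU|exact: measurableC].
  move=> x _; have [x01|] := pselect (`[0, 1]%classic x); last by right.
  left; have [|fx] := boolP (root f x); first by right.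
  left; apply: fN => /= h; move: fx; rewrite rootE => /eqP; apply.
  by have [] := h x01.
rewrite measureU0//; [|exact: measurableU|exact: measurableC].
have Z0 := nu_w_finite w m fZ.
by rewrite measureU0// N0 nu_w_full// lee_fin ler10.
Qed.

(** A Markov-type bound: only [[0, t[] is kept, and its mass is [t^alpha]. *)
Lemma pint_nu_w_lb f b t : 0 < t <= 1 ->
  (forall x, 0 <= x <= 1 -> 0 <= f.[x]) ->
  (forall x, 0 <= x < t -> b <= f.[x]) ->
  b * t `^ alpha <= pint nuw f.
Proof.
move=> t01 f0 fb; have intf D := integrable_horner nuw_fin nuw_supp f (D := D).
have split01 : `[0, 1]%classic = `[0, t[ `|` `[t, 1] :> set (measurableTypeR R).
  apply/seteqP; split=> x /=; rewrite !in_itv/=; last by case; lra.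
  by move=> /andP[-> ->]; rewrite andbT; have [|] := leP t x; [right|left].
rewrite (pint_restrict f nuw_fin nuw_supp (mcc 0 1))// split01 Rintegral_setU//.
- rewrite -[leLHS]addr0; apply: lerD; last first.
    by apply: Rintegral_ge0 => x /=; rewrite in_itv/= => ?; apply: f0; lra.
  rewrite -[X in _ * X]/(fine (t `^ alpha)%:E) -(nu_w_itvco alpha_gt0 t01).
  rewrite -Rintegral_cst//.
  apply: (le_Rintegral (mco 0 t) _ (intf _ (mco 0 t))); last first.
    by move=> x /=; rewrite in_itv/=; exact: fb.
  apply: eq_integrable (integrable_horner nuw_fin nuw_supp b%:P (mco 0 t)) => //.
  by move=> x _; rewrite /= hornerC.
- by apply: intf; exact: measurableU.
- apply/disj_setPS => x /= []; rewrite !in_itv/=; lra.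
Qed.

End MomentComparison.

(** * Eigenvalue bounds from a test polynomial *)

Section NuComparison.
Context {R : realType} (n m : nat) (w : 'I_n -> nat).
Context (g : mpoly.mpoly n R) (G : R).
Local Notation alpha := (wdeg R w m).
Local Notation nuw := (nu_w R w m).
Local Notation halfline t := (`]-oo, t%R[%classic : set (measurableTypeR R)).
Implicit Types f p d : {poly R}.
Hypothesis m_gt0 : (0 < m)%N.
Hypothesis alpha_gt0 : 0 < alpha.
Hypothesis g_ge0 : forall x : Rn R n, 0 <= peval g x.
Hypothesis g_homo : forall (t : R) (x : Rn R n), 0 < t ->
  peval g [tuple t ^+ w i * tnth x i | i < n] = t ^+ m * peval g x.
Hypothesis g_sublevel : [set x | peval g x <= 1] `<=` cube (n := n).
Hypothesis G_gt1 : 1 < G.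
Hypothesis g_leG : forall x : Rn R n, cube x -> peval g x <= G.

(** The constant [l0]: the fraction of the cube on which [g < 1]. *)
Definition nu_unit_mass : R := fine (nu g (halfline 1)).

Let nu_fin : (nu g setT < +oo)%E.
Proof. by rewrite nu_setT ltry. Qed.

Let nu_supp : nu g (~` `[0, G]%classic) = 0%E.
Proof.
apply: nu_compl => x cx; apply; rewrite /= in_itv/= g_ge0; exact: g_leG.
Qed.

Let nuw_fin : (nuw setT < +oo)%E.
Proof. by rewrite nu_w_full// ltry. Qed.

Let nuw_supp : nuw (~` `[0, 1]%classic) = 0%E.
Proof. by apply: (nu_w_null w m (a := 0)) => x []. Qed.

Let mI : measurable (`[0, 1[%classic : set (measurableTypeR R)).
Proof. exact: measurable_itv. Qed.

Let nuw_I : nuw (~` `[0, 1[%classic) = 0%E.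
Proof.
apply: (nu_w_null w m (a := 1)) => x /=; rewrite !in_itv/= => -[/negP].
by rewrite negb_and -leNgt -ltNge => /orP[]; lra.
Qed.

(** Integrated form of [nu_eq_nu_w]; the right side may run over the whole line because [[0, 1[]
    carries all of [nu_w]. *)
Lemma Rintegral_nu_unit f : (forall t, 0 <= t <= 1 -> 0 <= f.[t]) ->
  \int[nu g]_(t in `[0, 1[) f.[t] = nu_unit_mass * pint nuw f.
Proof.
move=> f0; rewrite (pint_restrict f nuw_fin nuw_supp mI nuw_I).
have k0 : 0 <= nu_unit_mass by rewrite fine_ge0.
have fin1 : nu g (halfline 1) \is a fin_num.
  rewrite ge0_fin_numE//; apply: le_lt_trans nu_fin.
  by apply: le_measure; rewrite ?inE//; exact: measurable_itv.
have intf := integrable_horner nuw_fin nuw_supp f mI.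
rewrite -[RHS]/(fine nu_unit_mass%:E * _) -fineM//; last first.
  exact: integrable_fin_num.
congr fine.
rewrite (eq_measure_integral (mscale (NngNum k0) nuw)).
  apply: ge0_integral_mscale => //; first exact: (measurable_int _ intf).
  by move=> x /=; rewrite in_itv/= => ?; rewrite lee_fin; apply: f0; lra.
move=> A mA A1; rewrite [LHS](nu_eq_nu_w (w := w) (m := m))//.
  by rewrite -[X in (X * _)%E]fineK.
by apply: subset_trans A1 _ => x /=; rewrite !in_itv/=; lra.
Qed.

(** On [[0, 1[] the integral is exactly [nu_unit_mass * pint nuw f]; on [[1, G]] it is at most [c]
    times a mass that does not exceed 1. *)
Lemma pint_nu_le f c : 0 <= c -> (forall t, 1 <= t <= G -> f.[t] <= c) ->
  (forall t, 0 <= t <= 1 -> 0 <= f.[t]) \/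
    (forall t, 0 <= t <= 1 -> f.[t] <= 0) ->
  pint (nu g) f <= nu_unit_mass * pint nuw f + c.
Proof.
move=> c0 fc fsgn.
have intf p (D : set (measurableTypeR R)) (mD : measurable D) :=
  integrable_horner nu_fin nu_supp p mD.
have mJ : measurable (`[1, G]%classic : set (measurableTypeR R)).
  exact: measurable_itv.
have -> : pint (nu g) f =
    \int[nu g]_(t in `[0, 1[) f.[t] + \int[nu g]_(t in `[1, G]) f.[t].
  have m0G : measurable (`[0, G]%classic : set (measurableTypeR R)).
    exact: measurable_itv.
  rewrite (pint_restrict f nu_fin nu_supp m0G nu_supp).
  have -> : `[0, G]%classic = `[0, 1[ `|` `[1, G] :> set (measurableTypeR R).
    apply/seteqP; split=> x /=; rewrite !in_itv/=.
      by move=> /andP[-> ->]; rewrite andbT; have [|] := leP 1 x; [right|left].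
    by move: G_gt1 => G1 [] /andP[? ?]; apply/andP; split; lra.
  apply: Rintegral_setU => //; first by apply: intf; exact: measurableU.
  by apply/disj_setPS => x /= []; rewrite !in_itv/=; lra.
apply: lerD.
  case: fsgn => fsgn; first by rewrite Rintegral_nu_unit.
  (* A nonpositive [f] is treated through its opposite. *)
  have := @Rintegral_nu_unit (-1 *: f).
  rewrite (pintZ nuw_fin nuw_supp).
  under eq_Rintegral do rewrite hornerZ.
  rewrite RintegralZl//; last exact: intf.
  move=> /(_ _)/wrap[t t01|]; last lra.
  by rewrite hornerZ mulN1r oppr_ge0 fsgn.
apply: (@le_trans _ _ (c * fine (nu g `[1, G]%classic))).
  rewrite -Rintegral_cst//; apply: (le_Rintegral mJ (intf _ _ mJ)); last first.
    by move=> x /=; rewrite in_itv/=; exact: fc.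
  apply: eq_integrable (intf c%:P _ mJ) => //.
  by move=> x _; rewrite /= hornerC.
rewrite -[leRHS]mulr1 ler_wpM2l// -lee_fin fineK.
  by rewrite -(nu_setT g); apply: le_measure; rewrite ?inE.
rewrite ge0_fin_numE//; apply: le_lt_trans nu_fin.
by apply: le_measure; rewrite ?inE.
Qed.

(** The Rayleigh bound at the coefficient vector of [p]. The second matrix is positive definite
    since [d * p^2] is a nonzero polynomial, nonnegative on [[0, 1]], for every nonzero [p]. *)
Lemma lambda_min_localizing_le k a d p : (size p <= k)%N -> p != 0 -> d != 0 ->
  (forall t, 0 <= t <= 1 -> 0 <= d.[t]) ->
  lambda_min (localizing_mx k a (nu g)) (localizing_mx k d nuw) *
    pint nuw (d * p ^+ 2) <= pint (nu g) (a * p ^+ 2).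
Proof.
move=> sp p0 d0 dpos.
rewrite -{1}(poly_rV_K sp) -{2}(poly_rV_K sp).
rewrite -(qform_localizing nuw_fin nuw_supp) -(qform_localizing nu_fin nu_supp).
apply: lambda_min_Rayleigh; rewrite ?localizing_mx_tr//; last first.
  by apply: contra_neq p0 => u0; rewrite -(poly_rV_K sp) u0 linear0.
move=> u u0; rewrite (qform_localizing nuw_fin nuw_supp).
apply: pint_nu_w_gt0 => //.
  rewrite mulf_neq0// expf_neq0//; apply: contra_neq u0 => u0.
  by rewrite -[u]rVpolyK u0 linear0.
by move=> t t01; rewrite hornerM horner_exp mulr_ge0 ?sqr_ge0// dpos.
Qed.

(** The Rayleigh quotient of [p] is at most [e * l0 + c / W], where [W], the integral of [d * p^2]
    against [nu_w], is at least [b * t^alpha]. The sign [e] covers both matrix pairs: [e = 1],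
    [d = 1] for [v_plus], and [e = -1], [d = - hpoly gbar] for [v_minus]. *)
Lemma lambda_min_excess k (e : R) d p c b t :
  (size p <= k)%N -> p != 0 -> d != 0 ->
  (forall x, 0 <= x <= 1 -> 0 <= d.[x]) ->
  (forall x, 1 <= x <= G -> e * d.[x] * p.[x] ^+ 2 <= c) ->
  (forall x, 0 <= x < t -> b <= d.[x] * p.[x] ^+ 2) ->
  0 <= c -> 0 < b -> 0 < t <= 1 ->
  lambda_min (localizing_mx k (e *: d) (nu g)) (localizing_mx k d nuw) <=
    e * nu_unit_mass + c / (b * t `^ alpha).
Proof.
move=> sp p0 d0 dpos dc db c0 b0 t01.
have dp_ge0 x : 0 <= x <= 1 -> 0 <= (d * p ^+ 2).[x].
  by move=> x01; rewrite hornerM horner_exp mulr_ge0 ?sqr_ge0// dpos.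
have Wlb : b * t `^ alpha <= pint nuw (d * p ^+ 2).
  apply: pint_nu_w_lb => // x xt.
  by rewrite hornerM horner_exp db.
have bt0 : 0 < b * t `^ alpha.
  by rewrite mulr_gt0// powR_gt0//; case/andP: t01.
have W0 := lt_le_trans bt0 Wlb.
rewrite -(ler_pM2r W0).
apply: le_trans (lambda_min_localizing_le _ sp p0 d0 dpos) _.
rewrite -scalerAl; apply: le_trans (pint_nu_le (c := c) c0 _ _) _.
- by move=> x xG; rewrite hornerZ hornerM horner_exp mulrA dc.
- have [e0|e0] := leP 0 e; [left|right] => x x01; rewrite hornerZ.
    by rewrite mulr_ge0// dp_ge0.
  by rewrite mulr_le0_ge0 ?dp_ge0// ltW.
rewrite (pintZ nuw_fin nuw_supp) mulrDl mulrA [_ * e]mulrC lerD2l.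
by rewrite mulrAC ler_pdivlMr// ler_wpM2l.
Qed.

End NuComparison.

(** * Growth of the test polynomial near 0 and the final estimate *)

Lemma Bernoulli_ineq (R : realType) (x : R) k : 0 <= x <= 1 ->
  1 - k%:R * x <= (1 - x) ^+ k.
Proof.
move=> /andP[x0 x1]; elim: k => [|k IH]; first by rewrite mul0r subr0.
rewrite exprS; apply: (@le_trans _ _ ((1 - x) * (1 - k%:R * x))); last first.
  by rewrite ler_wpM2l// subr_ge0.
have : 0 <= k%:R * x * x by rewrite !mulr_ge0.
rewrite -natr1; lra.
Qed.

(** For [x < 1 / (2 r)] and [k <= r], Bernoulli's inequality gives [(1 - x)^k >= 1/2], hence
    [p(x) >= gamma^k / 4]. *)
Lemma Chebyshev_near0 (R : realType) (gamma : R) (p : {poly R}) k r :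
  0 < gamma -> (0 < r)%N -> (k <= r)%N ->
  (forall t, 0 <= t <= 1 -> (gamma * (1 - t)) ^+ k / 2 <= p.[t]) ->
  forall x, 0 <= x < (2 * r%:R)^-1 -> gamma ^+ (2 * k) / 16 <= p.[x] ^+ 2.
Proof.
move=> g0 r0 kr plb x /andP[x0 xr].
have r1 : 1 <= r%:R :> R by rewrite ler1n.
have rx : r%:R * x <= 1 / 2.
  move: xr; rewrite -div1r ltr_pdivlMr; last lra.
  lra.
have x1 : x <= 1 by nra.
have kx : k%:R * x <= 1 / 2.
  by apply: le_trans rx; rewrite ler_wpM2r// ler_nat.
have x01 : 0 <= x <= 1 by rewrite x0.
have := Bernoulli_ineq k x01; have := plb _ x01.
rewrite exprMn mulnC exprM; have : 0 < gamma ^+ k by rewrite exprn_gt0.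
set a := gamma ^+ k; set y := (1 - x) ^+ k => a0 ap yx.
have : a / 4 <= p.[x] by nra.
nra.
Qed.

Theorem theorem5 (R : realType) (n m : nat) (w : 'I_n -> nat) (gbar : R)
    (n_ge1 : (1 <= n)%N) (m_ge1 : (1 <= m)%N) (w_gt0 : forall i, (0 < w i)%N)
    (gbar_gt1 : 1 < gbar) :
  exists2 C : R, 0 < C &
    forall g : mpoly.mpoly n R,
      (forall x : Rn R n, 0 <= peval g x) ->
      (forall (t : R) (x : Rn R n), 0 < t ->
         peval g [tuple t ^+ w i * tnth x i | i < n] = t ^+ m * peval g x) ->
      (forall x : Rn R n, x <> [tuple 0 | i < n] -> 0 < peval g x) ->
      [set x | peval g x <= 1] `<=` cube (n := n) ->
      (exists2 x : Rn R n, cube x & peval g x = gbar) ->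
      (forall x : Rn R n, cube x -> peval g x <= gbar) ->
      forall r : nat, (1 <= r)%N ->
        let gamma := (Num.sqrt gbar + 1) / (Num.sqrt gbar - 1) in
        v_plus m w g r - v_minus m w gbar g r <=
          C * r%:R `^ wdeg R w m * gamma ^- (2 * r).
Proof.
pose q := Num.sqrt gbar; pose gamma := (q + 1) / (q - 1).
have q1 : 1 < q by rewrite -sqrtr1 ltr_sqrt// (lt_trans ltr01).
have gamma0 : 0 < gamma by rewrite divr_gt0//; lra.
set alpha := wdeg R w m.
have alpha0 : 0 < alpha.
  rewrite divr_gt0 ?ltr0n// (bigD1 (Ordinal n_ge1))//=.
  by rewrite addn_gt0 w_gt0.
have pow2 : 0 < (2 : R) `^ alpha by rewrite powR_gt0.
(* [2^n] is the common prefactor of the two bounds and [2^alpha] comes from [t = 1 / (2 r)]; the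
   summands 16 and [32 (gbar - 1) gamma^2] come from the moment and the localizing matrices. *)
exists (2 ^+ n * (2 `^ alpha * (16 + 32 * (gbar - 1) * gamma ^+ 2))).
  rewrite mulr_gt0 ?exprn_gt0// mulr_gt0// addr_gt0// mulr_gt0 ?exprn_gt0//.
  lra.
move=> g g_ge0 g_homo _ g_sub _ g_le r r_ge1 /=; rewrite -/q -/gamma.
(* The sign in [v_minus] turns the difference into a sum of two smallest eigenvalues, so upper
   bounds for both suffice. *)
rewrite /v_plus /v_minus mulNr opprK -mulrDr -!mulrA ler_pM2l ?exprn_gt0//.
have nuw_fin : (nu_w R w m setT < +oo)%E by rewrite nu_w_full// ltry.
have nuw_supp : nu_w R w m (~` `[0%R, 1%R]%classic) = 0%E.
  by apply: (nu_w_null w m (a := 0)) => x [].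
pose t : R := (2 * r%:R)^-1.
have r0 : 0 < r%:R :> R by rewrite ltr0n.
have t_half : t <= 1 / 2.
  rewrite /t invfM mulrC ler_pM2r ?invr_gt0// invf_le1//.
  by rewrite ler1n.
have t01 : 0 < t <= 1.
  rewrite invr_gt0 mulr_gt0//=; lra.
have tE : (t `^ alpha)^-1 = 2 `^ alpha * r%:R `^ alpha.
  have t0 : 0 < t by case/andP: t01.
  apply: (mulfI (lt0r_neq0 (powR_gt0 alpha t0))).
  rewrite divff ?lt0r_neq0 ?powR_gt0// -!powRM ?ltW ?mulr_gt0//.
  by rewrite mulVf ?powR1// lt0r_neq0 ?mulr_gt0.
have pn0 (p : {poly R}) k :
    (forall t, 0 <= t <= 1 -> (gamma * (1 - t)) ^+ k / 2 <= p.[t]) -> p != 0.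
  move=> plb; apply/eqP => p0; have := plb 0; rewrite p0 horner0 subr0 mulr1.
  have : 0 < gamma ^+ k by rewrite exprn_gt0.
  lra.
set l0 := nu_unit_mass g.
have plus : lambda_min (moment_mx r (nu g)) (moment_mx r (nu_w R w m)) <=
    l0 + 16 * gamma ^- (2 * r) * (2 `^ alpha * r%:R `^ alpha).
  have [p [sp pub plb]] := Chebyshev_test_poly r gbar_gt1.
  rewrite !moment_mx_localizing.
  (* Here [p^2 <= 1] on [[1, gbar]] gives [c = 1], and [b] is the bound on [p^2] over [[0, t[]. *)
  have := @lambda_min_excess _ n m w g gbar m_ge1 alpha0 g_ge0 g_homo g_sub
    gbar_gt1 g_le r.+1 1 1 p 1 (gamma ^+ (2 * r) / 16) t
    sp (pn0 _ _ plb) (oner_neq0 _).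
  rewrite scale1r mul1r -/l0 => /(_ _ _ _ _ _ _)/wrap[]//.
  - by move=> x _; rewrite hornerC.
  - by move=> x xG; rewrite hornerC !mul1r pub.
  - by move=> x xt; rewrite hornerC mul1r (Chebyshev_near0 _ _ _ plb xt).
  - by rewrite divr_gt0// exprn_gt0.
  move=> h; apply: le_trans h _; rewrite lerD2l invfM tE.
  by rewrite mul1r invf_div.
have minus : lambda_min (localizing_mx r (hpoly gbar) (nu g))
      (- localizing_mx r (hpoly gbar) (nu_w R w m)) <=
    - l0 + 32 * (gbar - 1) * gamma ^+ 2 * gamma ^- (2 * r) *
      (2 `^ alpha * r%:R `^ alpha).
  (* A matrix of size [r] admits test polynomials of degree at most [r - 1] only, which costs the
     factor [gamma^2]. *)
  have [k rk] : exists k, r = k.+1 by exists r.-1; rewrite prednK.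
  have [p [sp pub plb]] := Chebyshev_test_poly k gbar_gt1.
  rewrite (localizing_mxN nuw_fin nuw_supp).
  have hE x : (- hpoly gbar).[x] = (1 - x) * (gbar - x).
    by rewrite /hpoly !hornerE; ring.
  have hN : hpoly gbar = -1 *: - hpoly gbar by rewrite scaleN1r opprK.
  have h0 : - hpoly gbar != 0.
    apply/eqP => h0; have := hE 0; rewrite h0 horner0; lra.
  (* On [[1, gbar]], [(x - 1) (gbar - x) <= (gbar - 1)^2]; on [[0, t[],
     [(1 - x) (gbar - x) >= (gbar - 1) / 2] because [t <= 1/2]. The resulting quotient [c / b] is
     [32 (gbar - 1) gamma^(-2k)]. *)
  have := @lambda_min_excess _ n m w g gbar m_ge1 alpha0 g_ge0 g_homo g_sub
    gbar_gt1 g_le r (-1) _ p ((gbar - 1) ^+ 2)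
    ((gbar - 1) / 2 * (gamma ^+ (2 * k) / 16)) t _ (pn0 _ _ plb) h0.
  rewrite -hN mulN1r -/l0 => /(_ _ _ _ _ _ _ _)/wrap[]//.
  - by rewrite rk.
  - by move=> x /andP[x0 x1]; rewrite hE mulr_ge0//; lra.
  - move=> x xG; rewrite hE; have := pub x xG; have := sqr_ge0 p.[x].
    move: xG => /andP[x1 xG] s0 s1.
    have y0 : 0 <= (x - 1) * (gbar - x) by rewrite mulr_ge0// subr_ge0.
    apply: (@le_trans _ _ ((x - 1) * (gbar - x))); last by nra.
    rewrite [leLHS](_ : _ = (x - 1) * (gbar - x) * p.[x] ^+ 2); last by ring.
    by rewrite ler_piMr.
  - move=> x xt; rewrite hE; apply: ler_pM.
    + by lra.
    + by rewrite divr_ge0// exprn_ge0// ltW.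
    + have /andP[x0 x1] := xt.
      have : 0 <= (1 / 2 - x) * (gbar - 1) by rewrite mulr_ge0//; lra.
      have : 0 <= x * x by rewrite mulr_ge0.
      nra.
    + by apply: Chebyshev_near0 plb _ xt; rewrite ?rk.
  - by rewrite sqr_ge0.
  - by rewrite mulr_gt0// divr_gt0 ?exprn_gt0//; lra.
  move=> h; apply: le_trans h _.
  rewrite lerD2l invfM tE [leLHS]mulrA ler_pM2r; last first.
    by rewrite mulr_gt0 ?powR_gt0.
  rewrite rk le_eqVlt; apply/orP; left; apply/eqP.
  rewrite mulnS exprD; field.
  by apply/and3P; split; rewrite lt0r_neq0 ?exprn_gt0// subr_gt0.
(* In the sum of the two bounds [l0] cancels. *)
apply: le_trans (lerD plus minus) _.
by rewrite le_eqVlt; apply/orP; left; apply/eqP; ring.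
Qed.
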